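(* Let $q\geq 2$ be an integer and let $\rho\in[0,1]$. Then the second-order asymptotic optimal rate $\kappa_2(\rho,q)$ satisfies \[\kappa_2(\rho,q)=\begin{cases} 1-H_{q^2}(\rho) & \text{if } \rho\in[0,1-\frac{1}{q^2}), \\ 0 & \text{if } \rho\in[1-\frac{1}{q^2},1]. \end{cases}\]
   Context: Let $G_q$ be a finite Abelian group of size $q$ with operation $+$. For a positive integer $n$, $G_q^{n}$ is the set of vectors of length $n$ over $G_q$, and $G_q^{2\times n}$ is the set of $2\times n$ matrices over $G_q$, both with the entry-wise group operation. For a matrix $\mathbf{v}\in G_q^{2\times n}$, its $2$-weight $\mathrm{wt}^{(2)}(\mathbf{v})$ is the number of non-zero columns of $\mathbf{v}$ (i.e., the size of the union of the supports of its rows), and the $2$-distance is $d^{(2)}(\mathbf{v},\mathbf{u})=\mathrm{wt}^{(2)}(\mathbf{u}-\mathbf{v})$. A code is a (non-empty) subset $C\subseteq G_q^n$. Let $C^2\subseteq G_q^{2\times n}$ be the set of $2\times n$ matrices both of whose rows belong to $C$ (the rows may be equal). The second covering radius of $C$ is \[R_2(C)=\max_{\mathbf{u}\in G_q^{2\times n}}\ \min_{\mathbf{c}\in C^2} d^{(2)}(\mathbf{c},\mathbf{u}).\] For real $0\leq r\leq n$ define \[k_2(n,r,q)=\min\{\log_q|C| : C\subseteq G_q^n,\ R_2(C)\leq r\}\] (this depends only on $q$ and not on the choice of the group $G_q$), and \[\kappa_2(\rho,q)=\liminf_{n\to\infty}\frac{k_2(n,\rho n,q)}{n}.\] For an integer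 $Q\geq 2$, the $Q$-ary entropy function is $H_Q(x)=x\log_Q(Q-1)-x\log_Q(x)-(1-x)\log_Q(1-x)$, with $H_Q(0)=0$ by continuity. *)

(* Defs.v *)
From HB Require Import structures.
From mathcomp Require Import all_boot all_order all_algebra.
From mathcomp Require Import all_classical all_reals all_analysis.

Set Implicit Arguments.
Unset Strict Implicit.
Unset Printing Implicit Defensive.

Import Order.TTheory GRing.Theory Num.Theory.

Local Open Scope ring_scope.

Section Codes.
Variables (G : finZmodType) (n : nat).

Definition wt2 (v : 'M[G]_(2, n)) : nat := #|[set j | col j v != 0]%SET|.

Definition dist2 (v u : 'M[G]_(2, n)) : nat := wt2 (u - v).

Definition code2 (C : {set 'rV[G]_n}) : {set 'M[G]_(2, n)} :=
  [set v : 'M[G]_(2, n) | [forall i, row i v \in C]]%SET.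

(* The default value n of the inner minimum bounds every distance from above,
   so it plays no role as soon as C is non-empty. *)
Definition covering_radius2 (C : {set 'rV[G]_n}) : nat :=
  \max_(u : 'M[G]_(2, n)) \big[Order.min/n]_(c in code2 C) dist2 c u.

End Codes.

Definition log_base (R : realType) (b : nat) (x : R) : R := ln x / ln b%:R.

(* The code alphabet G determines the base q = #|G| of the logarithm. *)
Definition k2_set (R : realType) (G : finZmodType) (n : nat) (r : R) : set R :=
  [set log_base #|G| #|C|%:R | C in
    [set C : {set 'rV[G]_n} | (0 < #|C|)%N
                              /\ (covering_radius2 C)%:R <= r]]%classic.

(* This infimum is a minimum for 0 <= r, see k2_min. *)
Definition k2 (R : realType) (G : finZmodType) (n : nat) (r : R) : R :=
  inf (k2_set G n r).

Lemma k2_min (R : realType) (G : finZmodType) (n : nat) (r : R) :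
  0 <= r -> k2_set G n r (k2 G n r) /\ lbound (k2_set G n r) (k2 G n r).
Proof.
move=> r0; pose P (C : {set 'rV[G]_n}) :=
  (0 < #|C|)%N && ((covering_radius2 C)%:R <= r).
have PT : P (finset.setTfor 'rV[G]_n).
  apply/andP; split; first by apply/card_gt0P; exists 0; rewrite inE.
  suff -> : covering_radius2 (finset.setTfor 'rV[G]_n) = 0%N by [].
  apply/eqP; rewrite -leqn0; apply/bigmax_leqP => u _.
  have du : dist2 u u = 0%N.
    by rewrite /dist2 /wt2 subrr; apply: eq_card0 => j; rewrite !inE col0 eqxx.
  rewrite -[leqRHS]du.
  rewrite -leEnat; apply: bigmin_le_cond.
  by rewrite inE; apply/forallP => i; rewrite inE.
pose f (C : {set 'rV[G]_n}) : R := log_base #|G| #|C|%:R.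
have [C /andP[C0 Cr] Cmin] := @arg_minP _ _ _ _ P f PT.
have SC : k2_set G n r (f C) by exists C.
have lbC : lbound (k2_set G n r) (f C).
  by move=> _ [D [D0 Dr] <-]; apply: Cmin; rewrite /P D0.
suff -> : k2 G n r = f C by [].
apply/eqP; rewrite eq_le; apply/andP; split.
  by apply: ge_inf => //; exists (f C).
by apply: lb_le_inf => //; exists (f C).
Qed.

(* The liminf is taken in \bar R; the term n = 0 is irrelevant to it. *)
Definition kappa2 (R : realType) (G : finZmodType) (rho : R) : \bar R :=
  limn_einf (fun n : nat => (k2 G n (rho * n%:R) / n%:R)%:E).

(* No case split at x = 0 (or x = 1) is needed: the factor x (or 1 - x)
   annihilates the total function ln at 0. *)
Definition entropy (R : realType) (Q : nat) (x : R) : R :=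
  x * log_base Q (Q%:R - 1) - x * log_base Q x
  - (1 - x) * log_base Q (1 - x).

(* Main.v *)
Require Import Defs.
From mathcomp Require Import all_boot all_order all_algebra all_fingroup.
From mathcomp Require Import all_classical all_reals all_analysis.
From mathcomp Require Import ring lra.
Set Implicit Arguments.
Unset Strict Implicit.
Unset Printing Implicit Defensive.
Import Order.TTheory GRing.Theory Num.Theory.
Import numFieldNormedType.Exports.

(** Write [q = #|G|] and [Q = q ^ 2]; a pair of rows is a word of length [n] over
    the [Q] possible columns, and the 2-weight is its Hamming weight.  For a
    radius [rho * n] with [rho <= 1 - 1 / Q], the ball has about
    [Q ^ (n H_Q(rho))] elements.

    Lower bound.  The balls around the [#|C| ^ 2] elements of [C ^ 2] cover all
    [Q ^ n] matrices, so [#|C| ^ 2] is at least [Q ^ (n (1 - H_Q(rho)))]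
    ([sphere_covering_bound], [card_wt2_ball_le], [k2_ge]).  This is the claimed
    rate, since [Q = q ^ 2].

    Upper bound.  A random code must be shown to meet the sphere covering bound
    although the pairs of [C ^ 2] are far from independent.  Inside the ball take
    the set [T] of pairs of rows in which every nonzero column occurs exactly [m]
    times, with [m] the integer part of [rho * n / (Q - 1)]; it has the same
    exponential size as the ball.  [T] is an orbit of the coordinate permutations
    and is stable under exchange of the rows.  Hence, seen as a relation between
    the set [S] of its first rows and itself, it is regular of some degree [d]
    ([pair_word_regular]), so that [#|T| = #|S| * d] with [d <= #|S|]; in
    particular [d <= sqrt #|T| <= #|S|].  These inequalities are all that is
    needed to find a code of size [sqrt #|T| ^-1 * q ^ n], up to a factor linear
    in [n], such that every pair of words differs from a pair of codewords by an
    element of [T] ([exists_small_pair_cover]).  The code is a union of two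
    samples.  The first one meets every translate of [S] about as often as
    expected, because [S] is large, while no word is related to more than [O(n)]
    sampled points, because [d] is small; so the words related to the first sample
    form a set of size about [sqrt #|T|], and the second sample hits each of those
    sets.  All the probability used is the expectation of a product of independent
    factors ([exists_sample_below_mean]).

    Finally [#|T|] is a multinomial coefficient, estimated by elementary bounds on
    factorials, and both bounds on [k2 n (rho n) / n] converge to
    [1 - H_Q(rho)] ([cvg_k2]).  Beyond [1 - 1 / Q] the rate is squeezed between 0
    and its value 0 at that point. *)

(** * Rearrangements of a word *)

(** A permutation preserving [f] permutes each fibre, and is determined by its
    restrictions to the fibres. *)
Lemma leq_card_stabilizer (A : finType) (n : nat) (f : 'I_n -> A) :
  #|[set p : 'S_n | [forall j, f (p j) == f j]]| <=
    \prod_(a : A) (#|[set j | f j == a]|)`!.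
Proof.
pose F a := [set j | f j == a].
have facts (p : 'S_n) a : [forall j, f (p j) == f j] -> p \in ('N(F a | 'P))%g.
  move=> /forallP hp; rewrite !inE; apply/fintype.subsetP => j; rewrite !inE /= => /eqP ja.
  by rewrite apermE (eqP (hp j)) ja.
pose h (p : 'S_n) : {ffun A -> 'S_n} := [ffun a => restr_perm (F a) p].
have hinj : {in [set p : 'S_n | [forall j, f (p j) == f j]] &, injective h}.
  move=> p r; rewrite !inE => pst rst /ffunP hpr; apply/permP => j.
  have := hpr (f j); rewrite !ffunE => /permP /(_ j).
  by rewrite !restr_permE ?facts // inE eqxx.
rewrite -(card_in_imset hinj).
pose B : A -> pred 'S_n := fun a => perm_on (F a).
apply: (@leq_trans #|family B|).
  apply: subset_leq_card; apply/fintype.subsetP => _ /imsetP[p _ ->].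
  by apply/familyP => a; rewrite ffunE; exact: restr_perm_on.
rewrite card_family foldrE big_map big_enum /=; apply: leq_prod => a _.
by rewrite /B card_perm.
Qed.

(** The symmetric group acts transitively on the rearrangements of [s], and each
    of them is reached by as many permutations as there are in the stabilizer. *)
Lemma leq_fact_card_rearrangements (A : finType) (n : nat) (s : n.-tuple A) :
  n`! <= #|[set t : n.-tuple A | perm_eq t s]| *
         \prod_(a : A) (count_mem a s)`!.
Proof.
pose act (p : 'S_n) := [tuple tnth s (p i) | i < n].
have -> : n`! = \sum_(t in [set t : n.-tuple A | perm_eq t s]) #|[set p | act p == t]|.
  rewrite -card_Sn -sum1_card (partition_big act
    (mem [set t : n.-tuple A | perm_eq t s])) /=.
    by apply: eq_bigr => t _; rewrite -sum1_card; apply: eq_bigl => p; rewrite inE.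
  by move=> p _; rewrite inE; apply/tuple_permP; exists p.
rewrite -sum_nat_const; apply: leq_sum => t _.
have [->|[p0]] := set_0Vmem [set p | act p == t].
  by rewrite cards0.
rewrite inE => /eqP t0.
rewrite (eq_bigr (fun a => (#|[set j | tnth s j == a]|)`!)); last first.
  move=> a _; congr (_`!); rewrite -sum1_count big_tuple -sum1_card.
  by apply: eq_bigl => j; rewrite inE.
apply: leq_trans (leq_card_stabilizer (tnth s)).
rewrite -(card_imset _ (mulgI p0^-1)%g); apply: subset_leq_card.
apply/fintype.subsetP => _ /imsetP[p + ->]; rewrite inE => /eqP tp.
rewrite inE; apply/forallP => j; rewrite permM.
have := congr1 (fun t => tnth t (p0^-1%g j)) (etrans tp (esym t0)).
by rewrite !tnth_mktuple permKV => ->.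
Qed.

Local Open Scope ring_scope.

(** * Random samples *)

(** The left-hand side of the hypothesis is the expectation of the sum over [i] of
    [w i * \prod_j f i (a j)] when the [a j] are independent and uniform; some
    sample [a] does at least as well as the mean.  Each term encodes a bad event:
    the weights are chosen so that a value below 1 excludes it. *)
Lemma exists_sample_below_mean (R : realFieldType) (V I : finType) (M : nat)
    (w : I -> R) (f : I -> V -> R) :
  (0 < #|V|)%N ->
  \sum_i w i * ((\sum_v f i v) / #|V|%:R) ^+ M < 1 ->
  (forall i, 0 <= w i) -> (forall i v, 0 <= f i v) ->
  exists a : 'I_M -> V, forall i, w i * \prod_j f i (a j) < 1.
Proof.
move=> V0 avg w0 f0.
have NM0 : 0 < #|V|%:R ^+ M :> R by rewrite exprn_gt0 // ltr0n.
have [/existsP[a /forallP ha]|/existsPn hn] :=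
  boolP [exists a : {ffun 'I_M -> V}, [forall i, w i * \prod_j f i (a j) < 1]].
  by exists a.
exfalso; move: avg; apply/negP; rewrite -leNgt -(ler_pM2r NM0) mul1r.
rewrite big_distrl /= (eq_bigr (fun i => \sum_(a : {ffun 'I_M -> V})
    w i * \prod_j f i (a j))); last first.
  move=> i _; rewrite -big_distrr /= -(bigA_distr_bigA (fun=> f i)) /=.
  rewrite prodr_const card_ord expr_div_n -mulrA divfK //.
  by rewrite gt_eqF.
rewrite exchange_big /= -natrX -[M in (_ ^ M)%N]card_ord -card_ffun -sum1_card.
rewrite natr_sum; apply: ler_sum => a _.
have /forallPn[i] := hn a; rewrite -leNgt => /le_trans; apply.
rewrite (bigD1 i) //= lerDl sumr_ge0 // => j _.
by rewrite mulr_ge0 // prodr_ge0.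
Qed.

Lemma mean_indicator_weight (R : realType) (V : finType) (A : {set V}) (c : R) :
  (0 < #|V|)%N ->
  (\sum_v (if v \in A then c else 1)) / #|V|%:R =
    1 + (c - 1) * (#|A|%:R / #|V|%:R).
Proof.
move=> V0; have NV0 : #|V|%:R != 0 :> R by rewrite pnatr_eq0 -lt0n.
rewrite (eq_bigr (fun v => (if v \in A then c - 1 else 0) + 1)); last first.
  by move=> v _; case: ifP => _; rewrite ?subrK ?add0r.
rewrite big_split /= -big_mkcond /= !sumr_const -[_ *+ #|V|]mulr_natr mul1r.
by rewrite -[_ *+ #|A|]mulr_natr mulrDl divff // addrC mulrA.
Qed.

Lemma mean_indicator_weight_exp (R : realType) (V : finType) (A : {set V})
    (c : R) (M : nat) : (0 < #|V|)%N -> 0 <= c ->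
  ((\sum_v (if v \in A then c else 1)) / #|V|%:R) ^+ M <=
    expR (M%:R * ((c - 1) * (#|A|%:R / #|V|%:R))).
Proof.
move=> V0 c0; rewrite expRM_natl lerXn2r ?nnegrE ?expR_ge0 //.
  by rewrite divr_ge0 ?ler0n // sumr_ge0 // => v _; case: ifP.
by rewrite mean_indicator_weight // expR_ge1Dx.
Qed.

Lemma prod_indicator_weight (R : comNzRingType) (V : finType) (A : {set V})
    (c : R) (M : nat) (a : 'I_M -> V) :
  \prod_j (if a j \in A then c else 1) = c ^+ #|[set j | a j \in A]|.
Proof.
rewrite -big_mkcond /= -prodr_const; apply: eq_bigl => j.
by rewrite inE.
Qed.

Lemma sumr_cst (R : pzSemiRingType) (I : finType) (c : R) :
  \sum_(i : I) c = #|I|%:R * c.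
Proof. by rewrite sumr_const mulr_natl. Qed.

(** The factor 1/2 at each visit to [A i] and the factor 2 at each visit to [B j]
    turn the number of visits [X] into [2 ^- X] and [2 ^+ X], whose means are
    bounded by exponentials; the weights [2 ^ k] and [2 ^- K] set the thresholds.
    The two tails are treated together because the same sample must satisfy
    both. *)
Lemma exists_balanced_sample (R : realType) (V I J : finType)
    (A : I -> {set V}) (B : J -> {set V}) (M k K s d : nat) :
  (0 < #|V|)%N ->
  (forall i, s <= #|A i|)%N -> (forall j, #|B j| <= d)%N ->
  #|I|%:R * (2 ^+ k * expR (- (M%:R * (s%:R / #|V|%:R) / 2))) +
  #|J|%:R * (2 ^- K * expR (M%:R * (d%:R / #|V|%:R))) < 1 :> R ->
  exists a : 'I_M -> V,
    (forall i, k < #|[set l | a l \in A i]|)%N /\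
    (forall j, #|[set l | a l \in B j]| < K)%N.
Proof.
move=> V0 hA hB avg.
have NV : 0 < #|V|%:R :> R by rewrite ltr0n.
pose w (x : I + J) : R := match x with inl _ => 2 ^+ k | inr _ => 2 ^- K end.
pose f (x : I + J) (v : V) : R := match x with
  | inl i => if v \in A i then 2^-1 else 1
  | inr j => if v \in B j then 2 else 1 end.
have [|||a ha] := @exists_sample_below_mean R V _ M w f V0.
- rewrite big_sumType /=; apply: le_lt_trans avg; apply: lerD.
    rewrite -sumr_cst; apply: ler_sum => i _.
    apply: ler_wpM2l; first by rewrite exprn_ge0.
    apply: le_trans (mean_indicator_weight_exp _ _ V0 _) _ => //.
    rewrite ler_expR.
    have : s%:R / #|V|%:R <= #|A i|%:R / #|V|%:R :> R.
      by rewrite ler_pM2r ?invr_gt0 // ler_nat.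
    have : 0 <= M%:R :> R by rewrite ler0n.
    by nra.
  rewrite -sumr_cst; apply: ler_sum => i _.
  apply: ler_wpM2l; first by rewrite invr_ge0 exprn_ge0.
  apply: le_trans (mean_indicator_weight_exp _ _ V0 _) _ => //.
  rewrite ler_expR ler_wpM2l ?ler0n //.
  rewrite (_ : 2 - 1 = 1); last by lra.
  by rewrite mul1r ler_pM2r ?invr_gt0 // ler_nat.
- by case=> i /=; rewrite ?invr_ge0 exprn_ge0.
- by case=> i v /=; case: ifP; rewrite ?invr_ge0.
exists a; split=> [i|j].
  have := ha (inl i); rewrite /= prod_indicator_weight exprVn.
  rewrite ltr_pdivrMr ?exprn_gt0 // mul1r ltr_eXn2l //; lra.
have := ha (inr j); rewrite /= prod_indicator_weight mulrC.
by rewrite ltr_pdivrMr ?exprn_gt0 // mul1r ltr_eXn2l //; lra.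
Qed.

(** Here the factor 0 at each visit to [A i] makes the product 1 exactly when the
    sample misses [A i]. *)
Lemma exists_hitting_sample (R : realType) (V I : finType)
    (A : I -> {set V}) (M : nat) (z : R) :
  (0 < #|V|)%N -> (forall i, z <= #|A i|%:R) ->
  #|I|%:R * expR (- (M%:R * (z / #|V|%:R))) < 1 ->
  exists b : 'I_M -> V, forall i, exists l, b l \in A i.
Proof.
move=> V0 hA avg; have NV : 0 < #|V|%:R :> R by rewrite ltr0n.
pose f i (v : V) : R := if v \in A i then 0 else 1.
have [|//||b hb] := @exists_sample_below_mean R V _ M (fun=> 1) f V0.
- apply: le_lt_trans avg; rewrite -sumr_cst; apply: ler_sum => i _.
  rewrite mul1r; apply: le_trans (mean_indicator_weight_exp _ _ V0 _) _ => //.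
  rewrite ler_expR sub0r mulN1r mulrN lerN2 ler_wpM2l ?ler0n //.
  by rewrite ler_pM2r ?invr_gt0.
- by move=> i v; rewrite /f; case: ifP.
exists b => i; have := hb i; rewrite mul1r prod_indicator_weight.
have [->|[l]] := set_0Vmem [set l | b l \in A i]%SET.
  by rewrite cards0 expr0 ltxx.
by rewrite inE => hl _; exists l.
Qed.

(** * Codes covering all pairs of words *)

Lemma card_preim_subl (V : finZmodType) (u : V) (A : {set V}) :
  #|[set v | u - v \in A]%SET| = #|A|.
Proof.
rewrite -[RHS](@card_imset _ _ (fun v => u - v)); last first.
  by move=> x y /(congr1 (fun w => u - w)); rewrite !subKr.
apply: eq_card => v; rewrite inE; apply/idP/imsetP => [uv|[w wA ->]].
  by exists (u - v); rewrite ?subKr.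
by rewrite subKr.
Qed.

(** Double counting of the pairs [(i, z)] with [z] in [F i]: a union of many sets
    is large when no point is covered too often. *)
Lemma leq_card_bigcup_multiplicity (I V : finType) (F : I -> {set V})
    (D : {set I}) (d K : nat) :
  (forall i, i \in D -> d <= #|F i|)%N ->
  (forall z, #|[set i | z \in F i]| <= K)%N ->
  (#|D| * d <= #|\bigcup_i F i| * K)%N.
Proof.
move=> hd hK; apply: (@leq_trans (\sum_i #|F i|)%N).
  rewrite -sum_nat_const [leqRHS](bigID (mem D)) /=.
  by apply: leq_trans (leq_addr _ _); apply: leq_sum => i /hd.
rewrite (eq_bigr (fun i => \sum_z (z \in F i))%N); last first.
  move=> i _; rewrite -sum1_card big_mkcond; apply: eq_bigr => z _.
  by case: (z \in F i).
rewrite exchange_big /= (bigID (mem (\bigcup_i F i))) /=.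
rewrite [X in (_ + X)%N]big1 ?addn0; last first.
  move=> z hz; apply: big1 => i _; apply/eqP; rewrite eqb0.
  by apply: contra hz => zi; apply/bigcupP; exists i.
rewrite -sum_nat_const; apply: leq_sum => z _; apply: leq_trans (hK z).
rewrite -sum1_card [leqRHS]big_mkcond /=; apply: leq_sum => i _.
by rewrite inE; case: (z \in F i).
Qed.

Lemma expR2_inv_le (R : realType) : expR (- 2) <= 1 / 3 :> R.
Proof.
rewrite expRN div1r lef_pV2 ?posrE ?expR_gt0 //.
by have := expR_ge1Dx (2 : R); lra.
Qed.

Lemma exp2_le_expR (R : realType) (k : nat) : 2 ^+ k <= expR k%:R :> R.
Proof.
rewrite -[k%:R]mulr1 expRM_natl lerXn2r ?nnegrE ?expR_ge0 //.
by have := expR_ge1Dx (1 : R); lra.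
Qed.

Lemma exp2N_le_expR (R : realType) (k : nat) :
  2 ^- k <= expR (- (k%:R / 2)) :> R.
Proof.
rewrite expRN lef_pV2 ?posrE ?exprn_gt0 ?expR_gt0 // expRM_natl.
rewrite lerXn2r ?nnegrE ?expR_ge0 //.
have h := expR_ge1Dx (- 2^-1 : R); rewrite expRN in h.
rewrite -[leLHS]invrK -[leRHS]invrK lef_pV2 ?posrE ?invr_gt0 ?expR_gt0 //; lra.
Qed.

Lemma ltr_truncnS (R : archiRealFieldType) (x : R) : 1 <= x ->
  x <= (Num.truncn x).+1%:R <= x + 1.
Proof.
move=> x1; have /andP[h1 h2] : (Num.truncn x)%:R <= x < (Num.truncn x).+1%:R.
  by apply: truncn_itv; lra.
by rewrite ltW //= -natr1 lerD2r.
Qed.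

(** The factor [60 * (1 + ln #|V|)] apart, this size is optimal when [T] has
    [#|S| * d] elements, since each pair of codewords covers only that many of the
    [#|V| ^ 2] pairs of words.  With [t = sqrt (#|S| * d)] and [L = 1 + ln #|V|], the
    first sample [a] has density [8 L / t]: it meets each [u - S] at least [L]
    times as [t <= #|S|], and its multiplicities stay below [24 L] as [d <= t].
    Hence the set [Z u] of all [z] related to some [u - a l] has at least [t / 25]
    elements, and a second sample [b] of density [50 L / t] meets each
    [u2 - Z u1]. *)
Lemma exists_small_pair_cover (R : realType) (V : finZmodType) (T : rel V)
    (S : {set V}) (d : nat) :
  (forall x, x \in S -> d <= #|[set y | T x y]|)%N ->
  (forall y, #|[set x | T x y]| <= d)%N ->
  (0 < d <= #|S|)%N ->
  exists C : {set V},
    #|C|%:R <= 60 * (1 + ln #|V|%:R) * #|V|%:R / Num.sqrt (#|S| * d)%:R :> R /\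
    forall u1 u2, exists c1 c2,
      [/\ c1 \in C, c2 \in C & T (u1 - c1) (u2 - c2)].
Proof.
move=> dS dT /andP[d0 ds].
have V0 : (0 < #|V|)%N by apply/card_gt0P; exists 0.
have sV : (#|S| <= #|V|)%N by apply: max_card.
set N : R := #|V|%:R; set t : R := Num.sqrt _.
have N1 : 1 <= N by rewrite ler1n.
have N0 : 0 < N by lra.
have s1 : 1 <= #|S|%:R :> R by rewrite ler1n (leq_trans d0).
have d1 : 1 <= d%:R :> R by rewrite ler1n.
have dsR : d%:R <= #|S|%:R :> R by rewrite ler_nat.
have sN : #|S|%:R <= N by rewrite ler_nat.
have tt : t ^+ 2 = #|S|%:R * d%:R by rewrite sqr_sqrtr ?ler0n // natrM.
have t0 : 0 <= t by apply: sqrtr_ge0.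
have tp : 0 < t by nra.
have td : d%:R <= t by nra.
have ts : t <= #|S|%:R by nra.
pose L : R := 1 + ln N.
have L1 : 1 <= L by rewrite lerDl ln_ge0.
have eN : N = expR (L - 1) by rewrite /L addrC addrA addNr add0r lnK ?posrE.
(* The sample sizes are rounded up; the unit added is at most [L * N / t]. *)
have LNt : 1 <= L * N / t by rewrite ler_pdivlMr // mul1r; nra.
have /ltr_truncnS : 1 <= 8 * (L * N / t) by lra.
set M1 := (Num.truncn _).+1 => /andP[M1l M1u].
pose lam : R := M1%:R / N.
have lam0 : 0 <= lam by rewrite divr_ge0 ?ler0n ?ltW.
have [laml lamu] : 8 * L <= lam * t /\ lam * t <= 9 * L.
  have e1 : L = (L * N / t) * (t / N) by field; lra.
  have e2 : lam * t = M1%:R * (t / N) by rewrite /lam; ring.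
  have : 0 < t / N by rewrite divr_gt0.
  rewrite e2 e1; move: M1l M1u LNt; set X := L * N / t; set c := t / N => *.
  by split; nra.
have lams : 8 * L <= lam * #|S|%:R.
  by apply: le_trans laml _; rewrite ler_wpM2l.
have lamd : lam * d%:R <= 9 * L.
  by apply: le_trans lamu; rewrite ler_wpM2l.
(* The mean number of visits to [u - S] is [lam * #|S|].  For [k] up to a quarter
   of it, [2 ^ k] consumes at most half of the exponent in
   [expR (- lam * #|S| / 2)]. *)
have [k [kl ku]] : exists k : nat,
    lam * #|S|%:R / 8 <= k%:R /\ k%:R <= lam * #|S|%:R / 4.
  exists (Num.truncn (lam * #|S|%:R / 4)); move: lams.
  move: (lam * _) => y y8.
  have /truncn_itv/andP[h1 h2] : 0 <= y / 4 by lra.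
  by split=> //; move: h2; rewrite -[(Num.truncn _).+1%:R]natr1; lra.
(* [2 ^- K <= expR (- 12 * L)] outweighs the mean factor
   [expR (lam * d) <= expR (9 * L)] and the number [expR (2 * L - 2)] of events. *)
have /ltr_truncnS : 1 <= 24 * L by lra.
set K := (Num.truncn _).+1 => /andP[Kl Ku].
have e2 := expR2_inv_le R.
have [|||a [aA aB]] := @exists_balanced_sample R V V (V * V)%type
  (fun u => [set v | u - v \in S])
  (fun uz => [set v | T (uz.1 - v) uz.2]) M1 k K #|S| d V0.
- by move=> u; rewrite card_preim_subl.
- move=> [u z] /=; apply: leq_trans (dT z).
  by rewrite -(card_preim_subl u) subset_leq_card //; apply/fintype.subsetP => v; rewrite !inE.
- have h1 : #|V|%:R * (2 ^+ k * expR (- (M1%:R * (#|S|%:R / #|V|%:R) / 2))) <= 1 / 3 :> R.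
    apply: le_trans e2; rewrite -/N {1}eN.
    apply: (@le_trans _ _ (expR (L - 1) * (expR k%:R *
      expR (- (M1%:R * (#|S|%:R / N) / 2))))).
      by rewrite ler_wpM2l ?expR_ge0 // ler_wpM2r ?expR_ge0 ?exp2_le_expR.
    rewrite -!expRD ler_expR.
    have -> : M1%:R * (#|S|%:R / N) = lam * #|S|%:R by rewrite /lam; ring.
    lra.
  have h2 : #|{: V * V}|%:R * (2 ^- K * expR (M1%:R * (d%:R / #|V|%:R))) <= 1 / 3 :> R.
    apply: le_trans e2; rewrite card_prod natrM -/N {1 2}eN.
    apply: (@le_trans _ _ (expR (L - 1) * expR (L - 1) * (expR (- (K%:R / 2)) *
      expR (M1%:R * (d%:R / N))))).
      rewrite ler_wpM2l ?mulr_ge0 ?expR_ge0 // ler_wpM2r ?expR_ge0 //.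
      exact: exp2N_le_expR.
    rewrite -!expRD ler_expR.
    have -> : M1%:R * (d%:R / N) = lam * d%:R by rewrite /lam; ring.
    lra.
  by apply: le_lt_trans (lerD h1 h2) _; clear; lra.
pose F u l := [set z | T (u - a l) z]%SET.
pose Z u := (\bigcup_l F u l)%SET.
have Zcard u : (k * d <= #|Z u| * K)%N.
  apply: leq_trans (@leq_card_bigcup_multiplicity _ _ (F u)
    [set l | a l \in [set v | u - v \in S]]%SET d K _ _).
  - by rewrite leq_mul2r (ltnW (aA u)) orbT.
  - by move=> l; rewrite !inE => /dS.
  - move=> z; apply: leq_trans (ltnW (aB (u, z))); apply: subset_leq_card.
    by apply/fintype.subsetP => l; rewrite !inE.
have Zt u : t / 25 <= #|Z u|%:R :> R.
  have h : k%:R * d%:R <= #|Z u|%:R * K%:R :> R by rewrite -!natrM ler_nat.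
  have z0 : 0 <= #|Z u|%:R :> R by apply: ler0n.
  move: h z0; set z : R := #|Z u|%:R => h z0.
  have h3 : lam * t ^+ 2 / 8 <= z * (25 * L).
    apply: (@le_trans _ _ (z * K%:R)).
      by apply: le_trans h; rewrite tt; nra.
    by rewrite ler_wpM2l //; lra.
  have h4 : L * t <= z * (25 * L) by nra.
  have : t * L <= (z * 25) * L by lra.
  by rewrite ler_pM2r; lra.
have /ltr_truncnS : 1 <= 50 * (L * N / t) by lra.
set M2 := (Num.truncn _).+1 => /andP[M2l M2u].
have [||b hb] := @exists_hitting_sample R V (V * V)%type
  (fun u => [set v | u.2 - v \in Z u.1]) M2 (t / 25) V0.
- by move=> u; rewrite card_preim_subl.
- apply: (@le_lt_trans _ _ (expR (- 2))); last by lra.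
  rewrite card_prod natrM -/N {1 2}eN -!expRD ler_expR.
  have -> : M2%:R * (t / 25 / N) = M2%:R * (t / (25 * N)) by field; lra.
  suff : 2 * L <= M2%:R * (t / (25 * N)) by lra.
  have -> : 2 * L = 50 * (L * N / t) * (t / (25 * N)) by field; lra.
  by rewrite ler_wpM2r // divr_ge0 //; lra.
exists ([set a l | l : 'I_M1] :|: [set b l | l : 'I_M2])%SET; split.
  have hM : M1%:R + M2%:R <= 60 * (L * N / t) by lra.
  have -> : 60 * (1 + ln N) * N / t = 60 * (L * N / t) by rewrite /L; ring.
  apply: le_trans hM; rewrite -natrD ler_nat.
  apply: leq_trans (leq_card_setU _ _) _; apply: leq_add.
    by apply: leq_trans (leq_imset_card _ _) _; rewrite card_ord.
  by apply: leq_trans (leq_imset_card _ _) _; rewrite card_ord.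
move=> u1 u2; have [l] := hb (u1, u2); rewrite !inE /= => /bigcupP[i _]; rewrite inE => hi.
by exists (a i), (b l); rewrite !inE !imset_f ?orbT.
Qed.

(** * Pairs of words with prescribed columns *)

Definition pair_word (G : Type) (n : nat) (x y : 'rV[G]_n) : n.-tuple (G * G) :=
  [tuple (x 0 j, y 0 j) | j < n].

Lemma perm_eq_pair_word_col_perm (G : eqType) (n : nat) (p : 'S_n)
    (x y : 'rV[G]_n) :
  perm_eq (pair_word (col_perm p x) (col_perm p y)) (pair_word x y).
Proof.
apply/tuple_permP; exists p; congr tval; apply: eq_from_tnth => j.
by rewrite !tnth_mktuple !mxE.
Qed.

(** The relation holding for the pairs of rows whose columns form a rearrangement
    of [s] is a single orbit of the coordinate permutations, so all its first rows
    have the same number [d] of partners.  Since [s] is symmetric, so is the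
    relation: degrees on both sides agree, and the partners of a first row are
    themselves first rows, whence [d <= #|S|]. *)
Lemma pair_word_regular (G : finType) (n : nat) (s : n.-tuple (G * G)) :
  perm_eq [seq (ab.2, ab.1) | ab <- s] s ->
  let T (x y : 'rV[G]_n) := perm_eq (pair_word x y) s in
  exists (S : {set 'rV[G]_n}) (d : nat),
    [/\ forall x, x \in S -> (d <= #|[set y | T x y]|)%N,
        forall y, (#|[set x | T x y]| <= d)%N,
        (0 < d <= #|S|)%N &
        (#|[set t : n.-tuple (G * G) | perm_eq t s]| <= #|S| * d)%N].
Proof.
move=> sym T.
have Tsym x y : T x y -> T y x.
  move=> xy; have : perm_eq [seq (ab.2, ab.1) | ab <- pair_word x y] s.
    by apply: perm_trans (perm_map _ xy) sym.
  rewrite /T (_ : map _ _ = pair_word y x) //=.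
  by rewrite -map_comp; apply: eq_map => j.
pose S := [set x | [exists y, T x y]]%SET.
have S_T x y : T x y -> x \in S by move=> xy; rewrite inE; apply/existsP; exists y.
have deg_le x x' : x \in S -> x' \in S ->
    (#|[set y | T x y]%SET| <= #|[set y | T x' y]%SET|)%N.
  rewrite !inE => /existsP[y xy] /existsP[y' xy'].
  have /tuple_permP[p hp] : perm_eq (pair_word x' y') (pair_word x y).
    by apply: perm_trans xy' _; rewrite perm_sym.
  have {hp}xx' : x' = col_perm p x.
    apply/rowP => j; have := congr1 (fun t => tnth t j) (val_inj hp).
    by rewrite !tnth_mktuple mxE => -[].
  have inj : injective (@col_perm G 1 n p).
    by move=> a b /(congr1 (col_perm p^-1%g)); rewrite -!col_permM mulVg !col_perm1.
  rewrite -(card_imset _ inj); apply: subset_leq_card.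
  apply/fintype.subsetP => _ /imsetP[z + ->]; rewrite !inE xx' => xz.
  by apply: perm_trans (perm_eq_pair_word_col_perm _ _ _) xz.
pose x0 : 'rV[G]_n := \row_j (tnth s j).1.
pose y0 : 'rV[G]_n := \row_j (tnth s j).2.
have pair_wordK (t : n.-tuple (G * G)) :
    pair_word (\row_j (tnth t j).1) (\row_j (tnth t j).2) = t.
  by apply: eq_from_tnth => j; rewrite tnth_mktuple !mxE; case: (tnth t j).
have T0 : T x0 y0 by rewrite /T pair_wordK.
have x0S := S_T _ _ T0.
exists S, #|[set y | T x0 y]%SET|; split.
- by move=> x xS; apply: deg_le.
- move=> y; rewrite (eq_card (B := [set x | T y x]%SET)); last first.
    by move=> x; rewrite !inE; apply/idP/idP; apply: Tsym.
  have [yS|] := boolP (y \in S); first exact: deg_le.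
  rewrite inE => /existsPn yS; rewrite eq_card0 // => x.
  by rewrite inE; apply: negbTE; apply: yS.
- apply/andP; split; first by apply/card_gt0P; exists y0; rewrite inE.
  apply: subset_leq_card; apply/fintype.subsetP => y; rewrite inE => /Tsym.
  exact: S_T.
- apply: (@leq_trans #|[set xy : 'rV[G]_n * 'rV[G]_n | T xy.1 xy.2]%SET|).
    apply: leq_trans (leq_imset_card (fun xy => pair_word xy.1 xy.2) _).
    apply: subset_leq_card; apply/fintype.subsetP => t; rewrite inE => ts.
    apply/imsetP; exists (\row_j (tnth t j).1, \row_j (tnth t j).2).
      by rewrite inE /T pair_wordK.
    by rewrite pair_wordK.
  rewrite -sum1_card (eq_bigl (fun xy : 'rV[G]_n * 'rV[G]_n =>
    (xy.1 \in S) && T xy.1 xy.2)); last first.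
    move=> [x y]; rewrite inE /=; apply/idP/andP => [xy|[]//].
    by split=> //; apply: S_T xy.
  rewrite -(pair_big_dep (fun x => x \in S) T (fun _ _ => 1%N)) /=.
  rewrite -sum_nat_const; apply: leq_sum => x xS.
  rewrite sum1_card (eq_card (B := [set y | T x y]%SET)) ?deg_le //.
  by move=> y; rewrite inE.
Qed.

Lemma covering_radius2_le (G : finZmodType) (n : nat) (C : {set 'rV[G]_n})
    (r : nat) :
  (forall u1 u2, exists c1 c2, [/\ c1 \in C, c2 \in C &
     (count (predC1 (0%R, 0%R)) (pair_word (u1 - c1) (u2 - c2)) <= r)%N]) ->
  (covering_radius2 C <= r)%N.
Proof.
move=> cov; apply/bigmax_leqP => u _.
have [c1 [c2 [c1C c2C h]]] := cov (row 0 u) (row 1 u).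
apply: leq_trans h; pose c : 'M[G]_(2, n) := \matrix_(i, j) (if i == 0 then c1 else c2) 0 j.
apply: (@leq_trans (dist2 c u)).
  rewrite -leEnat; apply: bigmin_le_cond; rewrite inE; apply/forallP => i.
  have -> : row i c = if i == 0 then c1 else c2 by apply/rowP => j; rewrite !mxE.
  by case: ifP.
rewrite /dist2 /wt2 -sum1_card -sum1_count big_tuple big_mkcond [leqRHS]big_mkcond.
apply: leq_sum => j _; rewrite tnth_mktuple inE /= !mxE; case: eqP => //= hj.
case: eqP => // -[h0 h1]; case: hj; apply/colP => i; rewrite !mxE.
have [->|] := eqVneq i 0; first exact: h0.
by case: i => [[|[|//]] hi] // _; rewrite -[RHS]h1; congr (u _ _ - _); apply: val_inj.
Qed.

(** * Logarithms of factorials *)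

Lemma ln_succ_bounds (R : realType) (k : nat) : (0 < k)%N ->
  k%:R * (ln k.+1%:R - ln k%:R) <= (1 : R) <= k.+1%:R * (ln k.+1%:R - ln k%:R).
Proof.
move=> k0; have kp : 0 < k%:R :> R by rewrite ltr0n.
have kS : k.+1%:R = k%:R + 1 :> R by rewrite -natr1.
have h1 : ln (k.+1%:R) - ln (k%:R) <= k%:R^-1 :> R.
  rewrite -ln_div ?posrE ?ltr0n //.
  have -> : k.+1%:R / k%:R = 1 + k%:R^-1 :> R by rewrite kS; field; lra.
  by apply: le_ln1Dx; apply: lt_trans (_ : 0 < _); rewrite ?invr_gt0 // ltrN10.
have h2 : ln (k%:R) - ln (k.+1%:R) <= - k.+1%:R^-1 :> R.
  rewrite -ln_div ?posrE ?ltr0n //.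
  have -> : k%:R / k.+1%:R = 1 + (- k.+1%:R^-1) :> R by rewrite kS; field; lra.
  by apply: le_ln1Dx; rewrite ltrN2 invf_lt1 ?ltr0n // ltr1n.
apply/andP; split.
  by rewrite -ler_pdivlMl // mulr1.
by rewrite -ler_pdivrMl ?ltr0n // mulr1 -lerN2 opprB.
Qed.

Lemma ln_fact_ge (R : realType) (k : nat) :
  k%:R * ln k%:R - k%:R <= ln (k`!)%:R :> R.
Proof.
elim: k => [|k IH]; first by rewrite mul0r fact0 ln1 subr0.
rewrite factS natrM lnM ?posrE ?ltr0n ?fact_gt0 //.
have [->|k0] := posnP k; first by rewrite fact0 !ln1 mul1r; lra.
have /andP[h _] := ln_succ_bounds R k0.
by move: IH h; set l := ln k.+1%:R; rewrite -natr1; lra.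
Qed.

Lemma ln_fact_le (R : realType) (k : nat) :
  ln (k`!)%:R <= k.+1%:R * ln k.+1%:R - k%:R :> R.
Proof.
elim: k => [|k IH]; first by rewrite fact0 ln1 mulr0 subr0.
rewrite factS natrM lnM ?posrE ?ltr0n ?fact_gt0 //.
have /andP[_ h] := ln_succ_bounds R (ltn0Sn k).
move: IH h; set l := ln k.+2%:R; set l' := ln k.+1%:R.
by rewrite -[k.+2%:R]natr1 -[k.+1%:R]natr1; lra.
Qed.

(** * The upper bound at finite length *)

Lemma exists_balanced_word (A : finType) (a0 : A) (n m : nat) :
  (#|A|.-1 * m <= n)%N ->
  exists s : n.-tuple A, forall a,
    count_mem a s = if a == a0 then (n - #|A|.-1 * m)%N else m.
Proof.
move=> mn; pose s := nseq (n - #|A|.-1 * m) a0 ++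
  flatten [seq nseq m a | a <- enum (predC1 a0)].
have sizes : size s == n.
  rewrite size_cat size_nseq size_flatten /shape -map_comp.
  rewrite (eq_map (g := fun=> m)); last by move=> a /=; rewrite size_nseq.
  rewrite sumnE big_map big_enum /= sum_nat_const cardC1 subnK //.
exists (Tuple sizes) => a; rewrite /= count_cat count_nseq count_flatten.
rewrite -map_comp sumnE big_map big_enum /=.
rewrite (eq_bigr (fun b => if b == a then m else 0%N)); last first.
  by move=> b _; rewrite /= count_nseq /=; case: (b == a); rewrite ?mul1n ?mul0n.
rewrite /= [a0 == a]eq_sym; case: eqVneq => [->|aN].
  rewrite mul1n big1 ?addn0 // => b.
  by rewrite inE => /negbTE ->.
rewrite mul0n add0n (bigD1 a) /=; last by rewrite inE.
rewrite eqxx big1 ?addn0 // => b.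
by case/andP=> _ /negbTE ->.
Qed.

Lemma prod_balanced_word (A : finType) (a0 : A) (x y : nat) :
  (\prod_(a : A) (if a == a0 then x else y)`! = x`! * y`! ^ #|A|.-1)%N.
Proof.
rewrite (bigD1 a0) //= eqxx; congr (_ * _)%N.
rewrite (eq_bigr (fun=> y`!)) => [|a /negbTE -> //].
by rewrite prod_nat_const -(cardC1 a0).
Qed.

(** The multinomial coefficient with one block of size [n - A * m] and [A] blocks
    of size [m].  The linear terms of the factorial estimates cancel. *)
Lemma ln_multinomial_ge (R : realType) (A n m : nat) : (A * m <= n)%N ->
  n%:R * ln n%:R - (n - A * m).+1%:R * ln (n - A * m).+1%:R
    - A%:R * (m.+1%:R * ln m.+1%:R) <=
  ln (n`!)%:R - ln ((n - A * m)`! * m`! ^ A)%:R :> R.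
Proof.
move=> mn; rewrite natrM lnM ?posrE ?ltr0n ?expn_gt0 ?fact_gt0 //.
rewrite natrX lnXn ?ltr0n ?fact_gt0 // -[_ *+ A]mulr_natl.
have h1 := ln_fact_ge R n; have h2 := ln_fact_le R (n - A * m).
have h3 : A%:R * ln (m`!)%:R <= A%:R * (m.+1%:R * ln m.+1%:R - m%:R) :> R.
  by rewrite ler_wpM2l // ln_fact_le.
have e : n%:R = (n - A * m)%:R + A%:R * m%:R :> R.
  by rewrite -natrM -natrD subnK.
move: h1 h2 h3; set a := ln n%:R; set b := ln (n - _).+1%:R; set c := ln m.+1%:R.
by rewrite !mulrBr => h1 h2 h3; lra.
Qed.

Lemma k2_le (R : realType) (G : finZmodType) (n : nat) (r : R)
    (C : {set 'rV[G]_n}) :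
  0 <= r -> (0 < #|C|)%N -> (covering_radius2 C)%:R <= r ->
  k2 G n r <= log_base #|G| #|C|%:R.
Proof. by move=> r0 C0 Cr; apply: (k2_min G n r0).2; exists C. Qed.

(** The covering lemma applied to the relation of the balanced word, whose weight
    [A * m] bounds the covering radius; the subtracted half is the logarithm of
    the square root of the number of pairs in that relation. *)
Lemma k2_le_balanced (R : realType) (G : finZmodType) (n m : nat) (r : R) :
  let A := (#|G| ^ 2).-1 in
  (2 <= #|G|)%N -> (0 < n)%N -> (A * m <= n)%N -> (A * m)%:R <= r ->
  k2 G n r * ln #|G|%:R <=
    ln 60 + ln (1 + n%:R * ln #|G|%:R) + n%:R * ln #|G|%:R
    - (n%:R * ln n%:R - (n - A * m).+1%:R * ln (n - A * m).+1%:R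
       - A%:R * (m.+1%:R * ln m.+1%:R)) / 2.
Proof.
move=> A G2 n0 mn mr.
have cardA : #|{: G * G}|.-1 = A by rewrite card_prod.
have lnG : 0 < ln #|G|%:R :> R by rewrite ln_gt0 // ltr1n.
have [s hs] : exists s : n.-tuple (G * G), forall a,
    count_mem a s = if a == (0, 0) then (n - A * m)%N else m.
  by rewrite -cardA; apply: exists_balanced_word; rewrite cardA.
have sym : perm_eq [seq (ab.2, ab.1) | ab <- s] s.
  apply/allP => -[a b] _ /=; rewrite count_map hs.
  rewrite (eq_count (a2 := pred1 (b, a))) ?hs; last first.
    by move=> [c d] /=; rewrite !xpair_eqE andbC.
  by rewrite !xpair_eqE andbC.
have weight : count (predC1 (0, 0)) s = (A * m)%N.
  have := count_predC (pred1 (0, 0)) s; rewrite hs eqxx size_tuple => /eqP.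
  by rewrite -[X in _ == X](subnK mn) eqn_add2l => /eqP.
have [S [d [hS hT hd hc]]] := pair_word_regular sym.
have [C [Ccard Ccov]] := exists_small_pair_cover R hS hT hd.
have C0 : (0 < #|C|)%N.
  by have [c [_ [cC _ _]]] := Ccov 0 0; apply/card_gt0P; exists c.
have CR : (covering_radius2 C <= A * m)%N.
  apply: covering_radius2_le => u1 u2; have [c1 [c2 [c1C c2C /seq.permP h]]] := Ccov u1 u2.
  by exists c1, c2; split=> //; rewrite h weight.
have r0 : 0 <= r by apply: le_trans mr.
have := k2_le r0 C0 (le_trans (_ : _ <= (A * m)%:R) mr).
rewrite ler_nat => /(_ CR); rewrite ler_pdivlMr // => /le_trans; apply.
have Sd : (0 < #|S| * d)%N.
  by rewrite muln_gt0; case/andP: hd => d0 dS; rewrite d0 (leq_trans d0).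
have tau : ln (n`!)%:R - ln ((n - A * m)`! * m`! ^ A)%:R <= ln (#|S| * d)%:R :> R.
  have f0 : (0 < (n - A * m)`! * m`! ^ A)%N.
    by rewrite muln_gt0 expn_gt0 !fact_gt0.
  have Sf0 : (0 < #|S| * d * ((n - A * m)`! * m`! ^ A))%N.
    by rewrite muln_gt0 Sd f0.
  rewrite lerBlDr -lnM ?posrE ?ltr0n // -natrM.
  rewrite ler_ln ?posrE ?ltr0n ?fact_gt0 // ler_nat.
  apply: leq_trans (leq_fact_card_rearrangements s) _; apply: leq_mul => //.
  by rewrite (eq_bigr _ (fun a _ => congr1 _ (hs a))) prod_balanced_word cardA.
have := le_trans (ln_multinomial_ge R mn) tau.
set X := _ - _ - _ => hX.
have cV : ln #|{: 'rV[G]_n}|%:R = n%:R * ln #|G|%:R :> R.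
  by rewrite card_mx mul1n natrX lnXn ?ltr0n ?(ltnW G2) // -[_ *+ n]mulr_natl.
have V0 : (0 < #|{: 'rV[G]_n}|)%N by apply/card_gt0P; exists 0.
have nl : 0 <= n%:R * ln #|G|%:R :> R by rewrite mulr_ge0 // ltW.
have sq : ln (Num.sqrt (#|S| * d)%:R) = ln (#|S| * d)%:R / 2 :> R.
  have sq0 : 0 < Num.sqrt (#|S| * d)%:R :> R by rewrite sqrtr_gt0 ltr0n.
  by rewrite -[in RHS](sqr_sqrtr (ler0n R (#|S| * d))) lnXn // -[_ *+ 2]mulr_natr mulfK.
have l0 : 0 < 1 + n%:R * ln #|G|%:R :> R by lra.
apply: (@le_trans _ _ (ln (60 * (1 + ln #|{: 'rV[G]_n}|%:R) * #|{: 'rV[G]_n}|%:R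
    / Num.sqrt (#|S| * d)%:R))).
  by rewrite ler_ln ?posrE ?ltr0n // divr_gt0 ?mulr_gt0 ?sqrtr_gt0 ?ltr0n ?cV.
rewrite ln_div ?posrE ?sqrtr_gt0 ?ltr0n ?mulr_gt0 ?ltr0n ?cV //.
by rewrite !lnM ?posrE ?mulr_gt0 ?ltr0n // cV sq; lra.
Qed.

(** * The sphere covering bound *)

(** [ln (A + 1)] times the entropy function of an alphabet with [A + 1] letters, in
    the form in which it arises: per letter, [- ln] of the probability of a word of
    relative weight [rho] whose letters are independent, nonzero with probability
    [rho], and then uniform. *)
Definition scaled_entropy (R : realType) (A : nat) (rho : R) : R :=
  - ((1 - rho) * ln (1 - rho)) - rho * ln (rho / A%:R).

Lemma exists_close_codeword (G : finZmodType) (n : nat) (C : {set 'rV[G]_n})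
    (u : 'M[G]_(2, n)) :
  (0 < #|C|)%N -> exists2 c, c \in code2 C & (dist2 c u <= covering_radius2 C)%N.
Proof.
case/card_gt0P=> c0 c0C.
have h0 : (\matrix_(i, j) c0 0 j : 'M[G]_(2, n)) \in code2 C.
  rewrite inE; apply/forallP => i; rewrite (_ : row i _ = c0) //.
  by apply/rowP => j; rewrite !mxE.
have [c cC cmin] := @arg_minP _ _ _ _ (mem (code2 C)) (fun c => dist2 c u) h0.
exists c => //; apply: leq_trans (leq_bigmax u); rewrite -leEnat.
apply/bigmin_geP; split=> [|c' /cmin //].
by rewrite leEnat /dist2 /wt2 -[leqRHS]card_ord max_card.
Qed.

Lemma leq_card_code2 (G : finZmodType) (n : nat) (C : {set 'rV[G]_n}) :
  (#|code2 C| <= #|C| ^ 2)%N.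
Proof.
rewrite -mulnn -cardsX.
have inj : injective (fun v : 'M[G]_(2, n) => (row 0 v, row 1 v)).
  move=> v w [h0 h1]; apply/row_matrixP => i.
  have [->|] := eqVneq i 0; first exact: h0.
  case: i => [[|[|//]] hi] // _.
  by rewrite (_ : Ordinal hi = 1) //; apply: val_inj.
rewrite -(card_imset _ inj); apply: subset_leq_card.
apply/fintype.subsetP => _ /imsetP[v + ->]; rewrite !inE => /forallP h.
by rewrite !h.
Qed.

(** The balls centred at [code2 C] cover the space, and they are translates of the
    ball centred at 0. *)
Lemma sphere_covering_bound (G : finZmodType) (n r : nat) (C : {set 'rV[G]_n}) :
  (0 < #|C|)%N -> (covering_radius2 C <= r)%N ->
  (#|G| ^ (2 * n) <= #|C| ^ 2 * #|[set v : 'M[G]_(2, n) | wt2 v <= r]|)%N.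
Proof.
move=> C0 Cr; rewrite -card_mx.
apply: (@leq_trans #|\bigcup_(c in code2 C) [set u | dist2 c u <= r]%N%SET|).
  apply: subset_leq_card; apply/fintype.subsetP => u _.
  have [c cC hc] := exists_close_codeword u C0.
  by apply/bigcupP; exists c => //; rewrite inE (leq_trans hc).
apply: (@leq_trans (\sum_(c in code2 C) #|[set u | dist2 c u <= r]%N%SET|)%N).
  apply: (big_ind2 (fun (X : {set 'M[G]_(2, n)}) m => #|X| <= m)%N) => //.
    by rewrite cards0.
  by move=> X x Y y hX hY; apply: leq_trans (leq_card_setU _ _) (leq_add hX hY).
apply: leq_trans (leq_mul (leq_card_code2 C) (leqnn _)).
rewrite -sum_nat_const; apply: leq_sum => c _.
rewrite -(card_imset _ (@addIr _ (- c))); apply: subset_leq_card.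
by apply/fintype.subsetP => _ /imsetP[u + ->]; rewrite !inE.
Qed.

(** Choose the columns independently, 0 with probability [b = 1 - rho] and every
    other value with probability [a = rho / A].  As [a <= b], each matrix of the
    ball has probability at least that of a matrix of weight exactly [rho * n],
    namely [expR (- n * scaled_entropy A rho)], and the probabilities add up to
    at most 1. *)
Lemma card_wt2_ball_le (R : realType) (G : finZmodType) (n r : nat) (rho : R) :
  let A := (#|G| ^ 2).-1 in
  (2 <= #|G|)%N -> 0 <= rho < 1 -> rho / A%:R <= 1 - rho -> r%:R <= rho * n%:R ->
  #|[set v : 'M[G]_(2, n) | (wt2 v <= r)%N]%SET|%:R <=
    expR (n%:R * scaled_entropy A rho).
Proof.
move=> A G2 /andP[rho0 rho1] hA rn.
have Apos : 0 < A%:R :> R.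
  rewrite ltr0n /A -subn1 subn_gt0 (@leq_trans (2 ^ 2)) //.
  by rewrite leq_exp2r.
have [z|rhop] := eqVneq rho 0.
  have r0 : r = 0%N by apply/eqP; rewrite -leqn0 -(ler_nat R); move: rn; rewrite z mul0r.
  rewrite /scaled_entropy z subr0 ln1 !mul0r !mulr0 subr0 oppr0 mulr0 expR0.
  rewrite -[1]/(1%:R) ler_nat.
  apply: leq_trans (eq_leq (cards1 (0 : 'M[G]_(2, n)))).
  apply: subset_leq_card; apply/fintype.subsetP => v.
  rewrite !inE r0 leqn0 cards_eq0 => /eqP /setP h.
  apply/eqP/matrixP => i j; have := h j; rewrite !inE => /negbFE/eqP/colP/(_ i).
  by rewrite !mxE.
have {}rho0 : 0 < rho by rewrite lt0r rhop.
set a := rho / A%:R; set b := 1 - rho.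
have a0 : 0 < a by rewrite divr_gt0.
have b0 : 0 < b by rewrite subr_gt0.
have lab : ln a <= ln b by rewrite ler_ln.
pose p (x : 'cV[G]_2) := if x == 0 then b else a.
have sum_p : \sum_x p x = 1.
  rewrite (bigD1 0) //= /p eqxx (eq_bigr (fun=> a)); last by move=> x /negbTE ->.
  rewrite sumr_const cardC1 card_mx muln1 -/A -mulr_natr /a divfK ?gt_eqF //.
  by rewrite /b subrK.
have total : \sum_(v : 'M[G]_(2, n)) \prod_j p (col j v) = 1.
  pose h (f : {ffun 'I_n -> 'cV[G]_2}) : 'M[G]_(2, n) := \matrix_(i, j) f j i 0.
  rewrite (reindex h) /=; last first.
    apply: onW_bij; exists (fun v => [ffun j => col j v]).
      by move=> f; apply/ffunP => j; rewrite ffunE; apply/colP => i; rewrite !mxE.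
    by move=> v; apply/matrixP => i j; rewrite !mxE ffunE mxE.
  rewrite (eq_bigr (fun f : {ffun _ -> _} => \prod_j p (f j))); last first.
    move=> f _; apply: eq_bigr => j _; congr p.
    by apply/colP => i; rewrite !mxE.
  by rewrite -(bigA_distr_bigA (fun=> p)) /= prodr_const sum_p expr1n.
have weight (v : 'M[G]_(2, n)) : \prod_j p (col j v) =
    expR (n%:R * ln b + (wt2 v)%:R * (ln a - ln b)).
  rewrite (eq_bigr (fun j => expR (ln b + (col j v != 0)%:R * (ln a - ln b)))); last first.
    move=> j _; rewrite /p; case: eqP => _ /=.
      by rewrite mul0r addr0 lnK.
    by rewrite mul1r addrC subrK lnK.
  have -> : (wt2 v)%:R = \sum_j (col j v != 0)%:R :> R.
    rewrite /wt2 -sum1_card natr_sum big_mkcond; apply: eq_bigr => j _.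
    by rewrite inE; case: (_ == _).
  rewrite -expR_sum big_split /= sumr_const card_ord -mulr_suml.
  by rewrite -[_ *+ n in LHS]mulr_natl.
have ge_w (v : 'M[G]_(2, n)) : (wt2 v <= r)%N ->
    expR (- (n%:R * scaled_entropy A rho)) <= \prod_j p (col j v).
  move=> vr; rewrite weight ler_expR /scaled_entropy -/a -/b.
  have w : (wt2 v)%:R <= rho * n%:R by apply: le_trans rn; rewrite ler_nat.
  rewrite -[b * ln b]/((1 - rho) * ln b).
  have : 0 <= (rho * n%:R - (wt2 v)%:R) * (ln b - ln a) by rewrite mulr_ge0 ?subr_ge0.
  by lra.
have : #|[set v : 'M[G]_(2, n) | (wt2 v <= r)%N]%SET|%:R *
    expR (- (n%:R * scaled_entropy A rho)) <= 1.
  rewrite -[leRHS]total mulr_natl -sumr_const [leRHS](bigID (fun v => v \in [set v | wt2 v <= r]%N%SET)) /=.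
  apply: ler_wpDr.
    by apply: sumr_ge0 => v _; apply: prodr_ge0 => j _; rewrite /p; case: ifP => _; apply: ltW.
  by apply: ler_sum => v; rewrite inE => /ge_w.
by rewrite expRN ler_pdivrMr ?expR_gt0 // mul1r.
Qed.

Lemma k2_ge (R : realType) (G : finZmodType) (n : nat) (rho : R) :
  let A := (#|G| ^ 2).-1 in
  (2 <= #|G|)%N -> 0 <= rho < 1 -> rho / A%:R <= 1 - rho ->
  n%:R * (2 * ln #|G|%:R - scaled_entropy A rho) <=
    2 * ln #|G|%:R * k2 G n (rho * n%:R).
Proof.
move=> A G2 hrho hA.
have rn0 : 0 <= rho * n%:R by case/andP: hrho => r0 _; rewrite mulr_ge0.
have [[C [C0 Cr] <-] _] := k2_min G n rn0.
have lnG : 0 < ln #|G|%:R :> R by rewrite ln_gt0 // ltr1n.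
have [r [rR r_ge]] : exists r : nat,
    r%:R <= rho * n%:R /\ (covering_radius2 C <= r)%N by exists (covering_radius2 C).
have V := card_wt2_ball_le G2 hrho hA rR.
have cover := sphere_covering_bound C0 r_ge.
have B0 : (0 < #|[set v : 'M[G]_(2, n) | (wt2 v <= r)%N]%SET|)%N.
  by apply/card_gt0P; exists 0; rewrite inE /wt2 eq_card0 // => j; rewrite !inE col0 eqxx.
have G0 : (0 < #|G|)%N by apply: ltnW.
have : ln (#|G| ^ (2 * n))%:R <=
    ln (#|C| ^ 2 * #|[set v : 'M[G]_(2, n) | (wt2 v <= r)%N]%SET|)%:R :> R.
  by rewrite ler_ln ?posrE ?ltr0n ?expn_gt0 ?G0 ?muln_gt0 ?B0 ?expn_gt0 ?C0 // ler_nat.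
rewrite natrM !natrX lnM ?posrE ?exprn_gt0 ?ltr0n // !lnXn ?ltr0n //.
have : ln #|[set v : 'M[G]_(2, n) | (wt2 v <= r)%N]%SET|%:R <=
    n%:R * scaled_entropy A rho.
  by rewrite -ler_expR lnK ?posrE ?ltr0n.
rewrite -[_ *+ (2 * n)]mulr_natl -[_ *+ 2]mulr_natl natrM.
have -> : 2 * ln #|G|%:R * log_base #|G| #|C|%:R = 2 * ln #|C|%:R :> R.
  by rewrite /log_base; field; lra.
lra.
Qed.

(** * Asymptotics *)

Lemma entropyE (R : realType) (q : nat) (rho : R) :
  (2 <= q)%N -> 0 <= rho ->
  entropy (q ^ 2) rho = scaled_entropy (q ^ 2).-1 rho / (2 * ln q%:R).
Proof.
move=> q2 rho0; have q0 : (0 < q)%N by apply: ltnW.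
have lnq : 0 < ln q%:R :> R by rewrite ln_gt0 // ltr1n.
have A0 : (0 < (q ^ 2).-1)%N.
  by rewrite -subn1 subn_gt0 (@leq_trans (2 ^ 2)) // leq_exp2r.
have eA : (q ^ 2)%:R - 1 = (q ^ 2).-1%:R :> R.
  by rewrite -[in LHS](prednK (n := q ^ 2)) ?expn_gt0 ?q0 // -natr1 addrK.
rewrite /entropy /log_base eA natrX lnXn ?ltr0n // -[_ *+ 2]mulr_natl /scaled_entropy.
have [->|rhoN] := eqVneq rho 0.
  by rewrite !(mul0r, subr0) ln1; rewrite !(mul0r, mulr0, oppr0, subr0).
have rhop : 0 < rho by rewrite lt0r rhoN.
rewrite ln_div ?posrE ?ltr0n //; field; lra.
Qed.

Lemma k2_ge0 (R : realType) (G : finZmodType) (n : nat) (r : R) :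
  (2 <= #|G|)%N -> 0 <= r -> 0 <= k2 G n r.
Proof.
move=> G2 r0; have [[C [C0 _] <-] _] := k2_min G n r0.
by rewrite /log_base divr_ge0 // ln_ge0 // ler1n // ltnW.
Qed.

Lemma k2_nonincreasing (R : realType) (G : finZmodType) (n : nat) (r r' : R) :
  0 <= r' -> r' <= r -> k2 G n r <= k2 G n r'.
Proof.
move=> r'0 rr'; have [[C [C0 Cr] <-] _] := k2_min G n r'0.
by apply: k2_le => //; [apply: le_trans rr' | apply: le_trans rr'].
Qed.

Lemma k2_le_length (R : realType) (G : finZmodType) (n : nat) (r : R) :
  (2 <= #|G|)%N -> 0 <= r -> k2 G n r <= n%:R.
Proof.
move=> G2 r0; have lnG : 0 < ln #|G|%:R :> R by rewrite ln_gt0 // ltr1n.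
have cov : (covering_radius2 [set: 'rV[G]_n]%SET <= 0)%N.
  apply: covering_radius2_le => u1 u2; exists u1, u2; rewrite !inE; split=> //.
  rewrite leqn0 eqn0Ngt -has_count -all_predC; apply/allP => _ /mapP[j _ ->] /=.
  by rewrite !subrr !mxE eqxx.
have C0 : (0 < #|[set: 'rV[G]_n]%SET|)%N by apply/card_gt0P; exists 0; rewrite inE.
have Cr : (covering_radius2 [set: 'rV[G]_n]%SET)%:R <= r.
  by apply: le_trans r0; rewrite lern0 -leqn0.
apply: le_trans (k2_le r0 C0 Cr) _.
rewrite /log_base cardsT card_mx mul1n natrX lnXn ?ltr0n ?(ltnW G2) //.
by rewrite -[_ *+ n]mulr_natl mulfK // gt_eqF.
Qed.

(** [ln N = 2 * ln (sqrt N) <= 2 * sqrt N]. *)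
Lemma cvg_ln_div (R : realType) :
  ((ln n.+1%:R / n.+1%:R : R) @[n --> \oo] --> (0 : R))%classic.
Proof.
have h : ((2 * Num.sqrt (harmonic n) : R) @[n --> \oo] --> (0 : R))%classic.
  rewrite -[X in (_ --> X)%classic](mulr0 2) -(sqrtr0 R); apply: cvgMr.
  by apply: continuous_cvg; [exact: sqrt_continuous | exact: cvg_harmonic].
apply: (squeeze_cvgr _ (cvg_cst 0) h); apply: nearW => n.
rewrite divr_ge0 ?ln_ge0 ?ler1n //=.
have s0 : 0 < Num.sqrt n.+1%:R :> R by rewrite sqrtr_gt0.
have e : n.+1%:R = Num.sqrt n.+1%:R ^+ 2 :> R by rewrite sqr_sqrtr.
rewrite /harmonic /= sqrtrV // [X in ln X]e lnXn // [X in _ / X]e.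
rewrite ler_pdivrMr ?exprn_gt0 // -[_ *+ 2]mulr_natl expr2 !mulrA mulfVK ?gt_eqF //.
rewrite ler_wpM2l //; apply: ltW; exact: ln_sublinear.
Qed.

(** The condition [rho / A <= 1 - rho] means [rho <= 1 - 1 / (A + 1)], that is,
    zero is the likeliest column.  In the upper bound, [x n] and [y n] are the
    frequencies of a nonzero and of the zero column, shifted by [1 / n]: this
    keeps them positive, so that their logarithms make sense and the bound for
    factorials applies without exceptions.  The case [rho = 0] is separate because
    [x n] then tends to 0, where [ln] is discontinuous. *)
Lemma cvg_k2 (R : realType) (G : finZmodType) (rho : R) :
  let A := (#|G| ^ 2).-1 in
  (2 <= #|G|)%N -> 0 <= rho < 1 -> rho / A%:R <= 1 - rho ->
  (k2 G n (rho * n%:R) / n%:R @[n --> \oo] -->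
    1 - scaled_entropy A rho / (2 * ln #|G|%:R))%classic.
Proof.
move=> A G2 hrho hA; set L := 1 - _.
have l0 : 0 < ln #|G|%:R :> R by rewrite ln_gt0 // ltr1n.
set l := ln #|G|%:R in l0 L *.
have /andP[rho0 rho1] := hrho.
have Apos : 0 < A%:R :> R.
  by rewrite ltr0n /A -subn1 subn_gt0 (@leq_trans (2 ^ 2)) // leq_exp2r.
have lower n : L <= k2 G n.+1 (rho * n.+1%:R) / n.+1%:R.
  have := k2_ge n.+1 G2 hrho hA; rewrite -/A -/l => h.
  rewrite ler_pdivlMr // /L -(ler_pM2l (_ : 0 < 2 * l)) ?mulr_gt0 //.
  apply: le_trans h; rewrite le_eqVlt; apply/orP; left; apply/eqP.
  by field; lra.
rewrite -cvg_shiftS /=.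
have [z|rhoN] := eqVneq rho 0.
  apply: (squeeze_cvgr _ (cvg_cst L) (cvg_cst L)); apply: nearW => n.
  have E0 : scaled_entropy A rho = 0.
    by rewrite z /scaled_entropy subr0 ln1 mulr0 mul0r oppr0 addr0.
  rewrite lower /= ler_pdivrMr // /L E0 mul0r subr0 mul1r.
  by rewrite k2_le_length ?mulr_ge0.
have rhop : 0 < rho by rewrite lt0r rhoN.
pose m n := Num.truncn (rho * n.+1%:R / A%:R).
pose x n : R := (m n).+1%:R / n.+1%:R.
pose y n : R := (n.+1 - A * m n).+1%:R / n.+1%:R.
pose f n : R := ln n.+1%:R / n.+1%:R.
pose c : R := ln 60 + ln (1 + l).
pose U n := (c * n.+1%:R^-1 + f n) / l + 1 +
  ((1 + A%:R) * f n + y n * ln (y n) + A%:R * (x n * ln (x n))) / (2 * l).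
have mA n : (A * m n)%:R <= rho * n.+1%:R.
  have /truncn_itv/andP[h _] : 0 <= rho * n.+1%:R / A%:R.
    by rewrite divr_ge0 ?mulr_ge0 // ltW.
  by move: h; rewrite ler_pdivlMr // natrM mulrC.
have mn n : (A * m n <= n.+1)%N.
  rewrite -(ler_nat R); apply: le_trans (mA n) _.
  by rewrite -[leRHS]mul1r ler_wpM2r // ltW.
have upper n : k2 G n.+1 (rho * n.+1%:R) / n.+1%:R <= U n.
  have := k2_le_balanced G2 (ltn0Sn n) (mn n) (mA n).
  rewrite -/A -/l -/(m n); set k := k2 _ _ _.
  set N : R := n.+1%:R; set X : R := (m n).+1%:R; set Y : R := (_ - _).+1%:R.
  have N1 : 1 <= N by rewrite ler1n.
  have N0 : 0 < N by lra.
  have lnNl : ln (1 + N * l) <= ln N + ln (1 + l).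
    have Nl : 0 < N * l by rewrite mulr_gt0.
    by rewrite -lnM ?posrE // ?ler_ln ?posrE //; nra.
  have eX : X = N * x n by rewrite /x -/N -/X; field; lra.
  have eY : Y = N * y n by rewrite /y -/N -/Y; field; lra.
  have x0 : 0 < x n by rewrite divr_gt0.
  have y0 : 0 < y n by rewrite divr_gt0.
  have eXY : Y + A%:R * X = N + 1 + A%:R.
    have eN : N = (n.+1 - A * m n)%:R + A%:R * (m n)%:R.
      by rewrite -natrM -natrD subnK.
    by rewrite eN /X /Y -!natr1; ring.
  have -> : ln X = ln N + ln (x n) by rewrite eX lnM.
  have -> : ln Y = ln N + ln (y n) by rewrite eY lnM.
  have -> : N * ln N - Y * (ln N + ln (y n)) - A%:R * (X * (ln N + ln (x n))) =
      - (1 + A%:R) * ln N - N * (y n * ln (y n) + A%:R * (x n * ln (x n))).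
    rewrite [N * ln N](_ : _ = (Y + A%:R * X - 1 - A%:R) * ln N); last by rewrite eXY; ring.
    by rewrite eX eY; ring.
  move=> h; rewrite ler_pdivrMr // -(ler_pM2r l0).
  have -> : U n * N * l = c + ln N + N * l +
    ((1 + A%:R) * ln N + N * (y n * ln (y n) + A%:R * (x n * ln (x n)))) / 2.
    by rewrite /U /f -/N; field; lra.
  by rewrite /c; lra.
have cvgh : (n.+1%:R^-1 @[n --> \oo] --> (0 : R))%classic := @cvg_harmonic R.
have cvgf := @cvg_ln_div R.
have cvgx : (x n @[n --> \oo] --> rho / A%:R)%classic.
  have h : (rho / A%:R + n.+1%:R^-1 @[n --> \oo] --> rho / A%:R + 0)%classic.
    by apply: cvgD => //; exact: cvg_cst.
  rewrite addr0 in h.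
  apply: (squeeze_cvgr _ (cvg_cst (rho / A%:R)) h); apply: nearW => n.
  have N0 : 0 < n.+1%:R :> R by [].
  have /truncn_itv : 0 <= rho * n.+1%:R / A%:R.
    by rewrite divr_ge0 ?mulr_ge0 // ltW.
  rewrite -/(m n) => /andP[h1 h2]; apply/andP; split.
    by rewrite /x ler_pdivlMr // mulrAC ltW.
  by rewrite /x ler_pdivrMr // mulrDl mulVf ?gt_eqF // -natr1 lerD2r mulrAC.
have cvgy : (y n @[n --> \oo] --> 1 - rho)%classic.
  have -> : y = (fun n => 1 + n.+1%:R^-1 - A%:R * (x n - n.+1%:R^-1)).
    apply/funext => n; rewrite /y /x -natr1 natrB // natrM -[(m n).+1%:R]natr1.
    by field; rewrite addrC natr1.
  have -> : 1 - rho = 1 + 0 - A%:R * (rho / A%:R - 0) by field; lra.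
  apply: cvgB; first by apply: cvgD => //; exact: cvg_cst.
  by apply: cvgM; [exact: cvg_cst | apply: cvgB].
have cvglnx : (ln (x n) @[n --> \oo] --> ln (rho / A%:R))%classic.
  apply: continuous_cvg => //; apply: continuous_ln; exact: divr_gt0.
have cvglny : (ln (y n) @[n --> \oo] --> ln (1 - rho))%classic.
  by apply: continuous_cvg => //; apply: continuous_ln; rewrite subr_gt0.
have cvgU : (U n @[n --> \oo] --> L)%classic.
  have -> : L = (c * 0 + 0) / l + 1 + ((1 + A%:R) * 0 +
      (1 - rho) * ln (1 - rho) + A%:R * (rho / A%:R * ln (rho / A%:R))) / (2 * l).
    by rewrite /L /scaled_entropy; field; lra.
  apply: cvgD.
    apply: cvgD; last exact: cvg_cst.
    apply: cvgM; last exact: cvg_cst.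
    by apply: cvgD => //; apply: cvgM => //; exact: cvg_cst.
  apply: cvgM; last exact: cvg_cst.
  apply: cvgD; first apply: cvgD.
  - by apply: cvgM => //; exact: cvg_cst.
  - exact: cvgM.
  - by apply: cvgM; [exact: cvg_cst | exact: cvgM].
apply: (squeeze_cvgr _ (cvg_cst L) cvgU); apply: nearW => n.
by rewrite lower upper.
Qed.

(** At this point all letters are equally likely: the entropy is that of the uniform
    distribution. *)
Lemma scaled_entropy_uniform (R : realType) (A : nat) : (0 < A)%N ->
  scaled_entropy A (1 - 1 / A.+1%:R) = ln A.+1%:R :> R.
Proof.
move=> A0; rewrite /scaled_entropy.
have Ap : 0 < A%:R :> R by rewrite ltr0n.
have -> : (1 - 1 / A.+1%:R) / A%:R = A.+1%:R^-1 :> R.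
  by rewrite -natr1; field; lra.
have -> : 1 - (1 - 1 / A.+1%:R) = A.+1%:R^-1 :> R by rewrite div1r opprB addrC subrK.
by rewrite lnV ?posrE // div1r; ring.
Qed.

Theorem theorem1 (R : realType) (q : nat) (hq : (2 <= q)%N)
    (G : finZmodType) (hG : #|G| = q) (rho : R) (hrho : 0 <= rho <= 1) :
  kappa2 G rho =
    (if rho < 1 - 1 / q%:R ^+ 2 then 1 - entropy (q ^ 2) rho else 0)%:E.
Proof.
have G2 : (2 <= #|G|)%N by rewrite hG.
have /andP[rho0 rho1] := hrho.
set l := if _ then _ else _.
suff lim : (k2 G n (rho * n%:R) / n%:R @[n --> \oo] --> (l : R))%classic.
  rewrite /kappa2 (cvg_limn_einf_sup (l := l%:E)) //.
  by apply/cvg_EFin; [exact: nearW | exact: lim].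
pose A := (#|G| ^ 2).-1.
have Q4 : 4 <= q%:R ^+ 2 :> R.
  by rewrite -natrX ler_nat (@leq_trans (2 ^ 2)) // leq_exp2r.
have eA : A%:R = q%:R ^+ 2 - 1 :> R.
  rewrite -natrX -[in RHS](prednK (n := q ^ 2)) ?expn_gt0 ?(ltnW hq) //.
  by rewrite -[_.+1%:R]natr1 addrK /A hG.
have lnq : 0 < ln q%:R :> R by rewrite ln_gt0 // ltr1n.
have key (r : R) : 0 <= r <= 1 - 1 / q%:R ^+ 2 ->
    (k2 G n (r * n%:R) / n%:R @[n --> \oo] --> 1 - entropy (q ^ 2) r)%classic.
  move=> /andP[r0 r1]; rewrite entropyE // -hG; apply: cvg_k2 => //.
    rewrite r0 (le_lt_trans r1) // gtrBl divr_gt0 //; lra.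
  rewrite -/A eA ler_pdivrMr; last by lra.
  move: r1; rewrite lerBrDl -lerBrDr ler_pdivrMr; last by lra.
  lra.
rewrite /l; case: ltP => hr; first by apply: key; rewrite rho0 ltW.
(* Above the point of maximal entropy, compare with the radius at that point. *)
pose r : R := 1 - 1 / q%:R ^+ 2.
have r0 : 0 <= r by rewrite subr_ge0 ler_pdivrMr; lra.
have e1 : 1 - entropy (q ^ 2) r = 0.
  have := scaled_entropy_uniform R (A := (q ^ 2).-1).
  rewrite prednK ?expn_gt0 ?(ltnW hq) // natrX -/r => Er.
  rewrite entropyE // Er; last by rewrite -(ltr0n R) -hG -/A eA; lra.
  rewrite lnXn ?ltr0n ?(ltnW hq) // -[_ *+ 2]mulr_natl divff ?subrr //.
  by rewrite mulf_neq0 ?gt_eqF.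
have := key r; rewrite e1 => /(_ _) h.
apply: (squeeze_cvgr _ (cvg_cst 0) (h _)); last by rewrite r0 lexx.
apply: nearW => n; rewrite divr_ge0 ?k2_ge0 ?mulr_ge0 //=.
rewrite ler_wpM2r ?invr_ge0 //; apply: k2_nonincreasing; first by rewrite mulr_ge0.
by rewrite ler_wpM2r.
Qed.
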